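(* Let $n\ge1$ and $r\ge0$ be integers and $q,w,z$ indeterminates. Then \begin{align*} &\frac{(qw^2;q^2)_n}{(w^2;q)_n}\,\frac{(q^{-r}w/z;q)_n}{ (w/z;q)_n}\, {}_{4}\phi_3 \left[\begin{matrix} w/z,q^rwz,w^2/q,q^{-n}\\ wz,q^{-r}w/z,q^nw^2 \end{matrix};q,-q^{n-r+1} \right]\\ &=q^{-\binom{r}{2}}\,(-q;q)_{n-r}\,\frac{(qz^2;q^2)_r}{(qz^2;q)_r}\, {}_{6}\phi_5 \left[\begin{matrix} z^2,qz,-qz,q^nwz,qz/w,q^{-r}\\ z,-z,wz,q^{1-n}z/w,q^{r+1}z^2 \end{matrix};q,-q^{r-n} \right]. \end{align*}
   Context: $(a;q)_m=\prod_{l=0}^{m-1}(1-aq^l)$ for $m\ge0$. The symbol $(-q;q)_m$ equals $\prod_{k=1}^m(q^k+1)$ for $m\ge0$ and $\prod_{k=0}^{-m-1}(q^{-k}+1)^{-1}$ for $m<0$. ${}_{s+1}\phi_s\left[\begin{matrix}a_1,\dots,a_{s+1}\\ b_1,\dots,b_s\end{matrix};q,y\right]=\sum_{i\ge0}\frac{(a_1;q)_i\cdots(a_{s+1};q)_i}{(b_1;q)_i\cdots(b_s;q)_i}\frac{y^i}{(q;q)_i}$ (both series here terminate). *)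

(* Defs.v *)
From HB Require Import structures.
From mathcomp Require Import all_boot all_order all_algebra.
From mathcomp Require Import classical_sets fsbigop.
From mathcomp Require Import mpoly.

Set Implicit Arguments.
Unset Strict Implicit.
Unset Printing Implicit Defensive.

Import GRing.Theory.
Local Open Scope ring_scope.

Definition qpoch (K : fieldType) (a q : K) (m : nat) : K :=
  \prod_(0 <= l < m) (1 - a * q ^+ l).

(* (-q; q)_m for an integer index m.  Negz k is the integer -(k + 1), so that
   the range 0 <= j <= -m - 1 is 0 <= j <= k. *)
Definition qpochN (K : fieldType) (q : K) (m : int) : K :=
  match m with
  | Posz k => \prod_(1 <= j < k.+1) (q ^+ j + 1)
  | Negz k => \prod_(0 <= j < k.+1) (q ^- j + 1)^-1
  end.

Definition qhyp_term (K : fieldType) (s : nat)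
    (a : s.+1.-tuple K) (b : s.-tuple K) (q y : K) (i : nat) : K :=
  (\prod_(c <- a) qpoch c q i) / (\prod_(c <- b) qpoch c q i)
  * (y ^+ i / qpoch q q i).

(* The basic hypergeometric series {s+1}_phi_s, as the sum over all i : nat.
   The finitely supported sum \sum_(i \in A) is the sum of the nonzero terms
   when there are finitely many of them, i.e. when the series terminates
   (and it is 0 otherwise). *)
Definition qhyp (K : fieldType) (s : nat)
    (a : s.+1.-tuple K) (b : s.-tuple K) (q y : K) : K :=
  \sum_(i \in [set: nat]%classic) qhyp_term a b q y i.

(* F(X_0, X_1, X_2), the field of rational functions in three
   indeterminates. *)
Definition ratfun3 (F : fieldType) : fieldType := {fraction {mpoly F[3]}}.

Definition indet (F : fieldType) (i : 'I_3) : ratfun3 F :=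
  @FracField.tofrac {mpoly F[3]} 'X_i.

(* Main.v *)
Require Import Defs.
From mathcomp Require Import all_boot all_order all_algebra.
From mathcomp Require Import classical_sets fsbigop.
From mathcomp Require Import ring zify.
From mathcomp Require mpoly.

Import GRing.Theory.
Local Open Scope ring_scope.

(* Both series are terminating well-poised series.  Two applications of
   Bailey's lemma to the unit Bailey pair (i.e. Watson's transformation) turn
   the left-hand side, with a = w^2/q, and the right-hand side, with a = z^2,
   into balanced 4phi3 series.  These are related by Sears' transformation,
   obtained by applying the q-Saalschutz sum twice; after it, the two sums
   agree term by term.  The parameters +-sqrt(w^2/q) and +-z sqrt(q) only occur
   in the pairs (d; q)_k (-d; q)_k, so that no square root is needed. *)

(* (d; q)_n (e; q)_n as a function of s = d + e and m = d e. *)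
Definition qpoch2 {K : fieldType} (s m q : K) (n : nat) : K :=
  \prod_(0 <= l < n) (1 - s * q ^+ l + m * q ^+ l.*2).

(** * Pochhammer symbols and the q-Saalschutz sum *)

Section QPochhammer.
Context {K : fieldType}.
Implicit Types (a b q s m t : K) (j k n : nat).

Lemma qpoch0 a q : qpoch a q 0 = 1.
Proof. exact: big_geq. Qed.

Lemma qpochS a q n : qpoch a q n.+1 = qpoch a q n * (1 - a * q ^+ n).
Proof. exact: big_nat_recr. Qed.

Lemma qpochSl a q n : qpoch a q n.+1 = (1 - a) * qpoch (a * q) q n.
Proof.
elim: n => [|n IHn]; first by rewrite qpochS !qpoch0 expr0 mulr1 mulrC.
by rewrite qpochS IHn qpochS exprS !mulrA.
Qed.

Lemma qpochD a q n k : qpoch a q (n + k) = qpoch a q n * qpoch (a * q ^+ n) q k.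
Proof.
elim: k => [|k IHk]; first by rewrite addn0 qpoch0 mulr1.
by rewrite addnS !qpochS IHk exprD !mulrA.
Qed.

Lemma qpoch_neq0 a q n :
  (forall l, (l < n)%N -> a * q ^+ l != 1) -> qpoch a q n != 0.
Proof.
move=> ha; rewrite /qpoch big_mkord; apply/prodf_neq0 => l _.
by rewrite subr_eq0 eq_sym ha.
Qed.

Lemma qpoch2_0 s m q : qpoch2 s m q 0 = 1.
Proof. exact: big_geq. Qed.

Lemma qpoch2S s m q n :
  qpoch2 s m q n.+1 = qpoch2 s m q n * (1 - s * q ^+ n + m * q ^+ n.*2).
Proof. exact: big_nat_recr. Qed.

Lemma qpoch2D s m q n k :
  qpoch2 s m q (n + k) =
  qpoch2 s m q n * qpoch2 (s * q ^+ n) (m * q ^+ n.*2) q k.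
Proof.
elim: k => [|k IHk]; first by rewrite addn0 qpoch2_0 mulr1.
by rewrite addnS !qpoch2S IHk doubleD !exprD !mulrA.
Qed.

Lemma qpoch2_mul a b q n :
  qpoch2 (a + b) (a * b) q n = qpoch a q n * qpoch b q n.
Proof.
rewrite -big_split; apply: eq_bigr => l _ /=.
by rewrite -addnn exprD; ring.
Qed.

Lemma qpoch2_sqr m q n : qpoch2 0 (- m) q n = qpoch m (q ^+ 2) n.
Proof.
by apply: eq_bigr => l _; rewrite mul0r subr0 mulNr -exprM mul2n.
Qed.

Lemma qpoch_sqr a q n :
  qpoch (a ^+ 2) (q ^+ 2) n = qpoch a q n * qpoch (- a) q n.
Proof. by rewrite -qpoch2_mul subrr mulrN qpoch2_sqr. Qed.

(** Summation form of a recurrence like Pascal's rule: a term of the new row is a share [X] of the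
    old term at the same index plus a share [Y] of the preceding one. The two ends are separate
    conditions, so no index outside the old row occurs. *)
Lemma sum_pascal (f X Y : nat -> K) k :
    f 0%N = X 0%N -> f k.+1 = Y k ->
    (forall j, (j < k)%N -> f j.+1 = X j.+1 + Y j) ->
  \sum_(j < k.+2) f j = \sum_(j < k.+1) (X j + Y j).
Proof.
move=> f0 fk fj; rewrite big_ord_recl big_ord_recr /= /bump /= add1n f0 fk.
rewrite big_split /= [\sum_(i < k.+1) X i]big_ord_recl.
rewrite [\sum_(i < k.+1) Y i]big_ord_recr /= !addrA; congr (_ + _).
rewrite -addrA -big_split /=; congr (_ + _); apply: eq_bigr => i _.
by rewrite /bump /= add1n fj.
Qed.

(* With s = A + B and m = A B, this is the q-Saalschutz sum of
   3phi2(q^-n, A, B; tAB, q^(1-n)/t; q, q), cleared of the powers of q^-1. *)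
Lemma q_saalschutz s m t q n : (forall k, qpoch q q k != 0) ->
  \sum_(j < n.+1) t ^+ j * qpoch t q (n - j) * qpoch (t * m * q ^+ j) q (n - j)
      * qpoch2 s m q j / (qpoch q q j * qpoch q q (n - j))
  = qpoch2 (t * s) (t ^+ 2 * m) q n / qpoch q q n.
Proof.
move=> hq; have hq1 k : 1 - q ^+ k.+1 != 0.
  by have := hq k.+1; rewrite qpochS mulf_eq0 negb_or exprS => /andP[].
elim: n => [|n IHn].
  by rewrite big_ord1 subn0 !qpoch0 !qpoch2_0 !expr0 !mulr1 divr1.
rewrite qpoch2S qpochS -exprS invfM mulrACA -IHn mulr_suml.
(* [Y] is the Wilf-Zeilberger certificate of the summand [T]. *)
pose T j := t ^+ j * qpoch t q (n - j) * qpoch (t * m * q ^+ j) q (n - j)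
      * qpoch2 s m q j / (qpoch q q j * qpoch q q (n - j)).
(* [p / (1 - q ^+ n.+1)] is the ratio of consecutive right-hand sides. *)
pose p := 1 - t * s * q ^+ n + t ^+ 2 * m * q ^+ n.*2.
pose Y j := q ^+ (n - j) * t * (1 - s * q ^+ j + m * q ^+ j.*2) * T j
            / (1 - q ^+ n.+1).
pose X j := p * T j / (1 - q ^+ n.+1) - Y j.
under [RHS]eq_bigr => j _.
  have -> : T j * (p / (1 - q ^+ n.+1)) = X j + Y j by rewrite /X; ring.
  over.
have e2 k : q ^+ k.*2 = q ^+ k * q ^+ k by rewrite -addnn exprD.
apply: (@sum_pascal (fun j => t ^+ j * qpoch t q (n.+1 - j)
  * qpoch (t * m * q ^+ j) q (n.+1 - j)
      * qpoch2 s m q j / (qpoch q q j * qpoch q q (n.+1 - j)))).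
- rewrite /X /Y /T /p !subn0 !qpoch0 !qpoch2_0 !expr0 !e2 !qpochS -exprS.
  by field; rewrite hq hq1.
- rewrite /Y /T !subnn !qpochS !qpoch0 !qpoch2S !expr0 !e2.
  rewrite -!exprS exprS; field.
  by rewrite hq hq1.
move=> j ltjn; rewrite /X /Y /T /p.
(* Writing n = j + d + 1 removes the truncated subtractions before [field]. *)
have [d ->] : exists d, n = (j + d).+1.
  by exists (n - j.+1)%N; rewrite -addSn subnKC.
rewrite !subSS.
have -> : ((j + d).+1 - j)%N = d.+1 by lia.
have -> : (j + d - j)%N = d by lia.
rewrite [qpoch (_ * q ^+ j) q _]qpochSl.
rewrite [qpoch _ q d.+1]qpochS !qpoch2S !qpochS !e2.
rewrite -[_ * q ^+ j * q]mulrA -exprSr.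
have := hq1 j; have := hq1 d; have := hq1 (j + d).+1; move: (hq j) (hq d).
rewrite !exprS exprD => hj hd hjd1 hd1 hj1; field.
by rewrite hj hd hjd1 hd1 hj1.
Qed.

End QPochhammer.

(** * Bailey pairs, Bailey's lemma and Watson's transformation *)

Definition bailey_pair {K : fieldType} (a q : K) (alpha beta : nat -> K) :=
  forall n, beta n =
    \sum_(k < n.+1) alpha k / (qpoch q q (n - k) * qpoch (a * q) q (n + k)).

(** The sequence whose Bailey partner is 1 at 0 and 0 elsewhere; (1 - a q^(2k))/(1 - a) is the
    very-well-poised factor. *)
Definition unit_alpha {K : fieldType} (a q : K) (k : nat) : K :=
  (-1) ^+ k * q ^+ 'C(k, 2) * (1 - a * q ^+ k.*2) / (1 - a)
  * qpoch a q k / qpoch q q k.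

Section Bailey.
Context {K : fieldType}.
Implicit Types (a b c q s m t u : K) (j k n : nat) (alpha beta : nat -> K).

Lemma exchange_triangle (f : nat -> nat -> K) n :
  \sum_(j < n.+1) \sum_(k < j.+1) f j k =
  \sum_(k < n.+1) \sum_(i < (n - k).+1) f (k + i)%N k.
Proof.
elim: n => [|n IHn]; first by rewrite !big_ord1.
rewrite big_ord_recr /= IHn [RHS]big_ord_recr /= subnn big_ord1 addn0.
rewrite [\sum_(k < n.+2) f _ _]big_ord_recr /= addrA; congr (_ + _).
rewrite -big_split; apply: eq_bigr => k _ /=.
have lekn : (k <= n)%N by rewrite -ltnS.
by rewrite subSn // [RHS]big_ord_recr /= addnS subnKC.
Qed.

(** For n >= 1 the sum telescopes: its partial sums have the closed form [U], and [U N] cancels the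
    last term [T N]. *)
Lemma unit_bailey_pair {a q} :
    (forall k, qpoch q q k != 0) -> (forall k, qpoch a q k != 0) ->
  bailey_pair a q (unit_alpha a q) (fun n => (n == 0)%:R).
Proof.
move=> hq ha n.
have hq1 k : 1 - q ^+ k.+1 != 0.
  by have := hq k.+1; rewrite qpochS mulf_eq0 negb_or exprS => /andP[].
have haS k : 1 - a * q ^+ k != 0.
  by have := ha k.+1; rewrite qpochS mulf_eq0 negb_or => /andP[].
have ha1 : 1 - a != 0 by have := haS 0; rewrite mulr1.
have haq k : qpoch (a * q) q k != 0.
  by have := ha k.+1; rewrite qpochSl mulf_eq0 negb_or => /andP[].
have e2 k : q ^+ k.*2 = q ^+ k * q ^+ k by rewrite -addnn exprD.
case: n => [|n] /=.
  rewrite big_ord1 /unit_alpha !qpoch0 bin0n !expr0 !mulr1 !divr1.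
  by rewrite mul1r divff.
set N := n.+1.
pose T k := unit_alpha a q k / (qpoch q q (N - k) * qpoch (a * q) q (N + k)).
pose U k := - ((-1) ^+ k * q ^+ 'C(k, 2) * qpoch a q k * (1 - q ^+ k)
  * (1 - a * q ^+ (N + k))
  / ((1 - a) * qpoch q q k * qpoch q q (N - k) * qpoch (a * q) q (N + k)
     * (1 - q ^+ N))).
have telescope k : (k <= N)%N -> \sum_(i < k) T i = U k.
  elim: k => [|k IHk] ltkN.
    by rewrite big_ord0 /U subrr !(mulr0, mul0r, oppr0).
  rewrite big_ord_recr /= IHk 1?ltnW // /T /U /unit_alpha.
  have [d ->] : exists d, N = (k + d).+1.
    by exists (N - k.+1)%N; rewrite -addSn subnKC.
  rewrite subSS; have -> : ((k + d).+1 - k)%N = d.+1 by lia.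
  have -> : (k + d - k)%N = d by lia.
  rewrite addnS binS bin1 !qpochS !e2 ![((k + d).+1 + _)%N]addSn.
  rewrite !exprS !exprD.
  move: (hq k) (hq d) (hq1 k) (hq1 d) (hq1 (k + d)%N) (haq (k + d + k)%N).
  move: (haS (k + d + k).+1) (haS (k + d + k).+2).
  rewrite !exprS !exprD => *.
  field.
  by apply/and5P; split; rewrite -?[a * q * _]mulrA //; apply/and5P; split.
rewrite big_ord_recr /= -/(T N).
under eq_bigr do rewrite -/(T _).
rewrite telescope // /U /T /unit_alpha subnn qpoch0 e2 exprD.
by field; rewrite haq hq ha1 hq1.
Qed.

(** With s = d + e and m = d e, [t] stands for a q/(d e), so that t d = a q/e and t e = a q/d. Once
    the summations are exchanged, the coefficient of [alpha k] is a q-Saalschutz sum in d q^k and e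
    q^k. *)
Lemma bailey_lemma {a q s m t alpha beta} : t * m = a * q ->
    (forall k, qpoch q q k != 0) -> (forall k, qpoch (a * q) q k != 0) ->
    (forall k, qpoch2 (t * s) (t ^+ 2 * m) q k != 0) ->
    bailey_pair a q alpha beta ->
  bailey_pair a q
    (fun k => qpoch2 s m q k * t ^+ k / qpoch2 (t * s) (t ^+ 2 * m) q k
              * alpha k)
    (fun n => (\sum_(j < n.+1) qpoch2 s m q j * t ^+ j * qpoch t q (n - j)
                 / qpoch q q (n - j) * beta j)
              / qpoch2 (t * s) (t ^+ 2 * m) q n).
Proof.
move=> tm hq haq hP hab n.
under eq_bigr do rewrite hab mulr_sumr.
rewrite (exchange_triangle (fun j k =>
  qpoch2 s m q j * t ^+ j * qpoch t q (n - j) / qpoch q q (n - j)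
  * (alpha k / (qpoch q q (j - k) * qpoch (a * q) q (j + k))))).
rewrite mulr_suml; apply: eq_bigr => -[k /= ltkn] _.
have {ltkn} [d ->] : exists d, n = (k + d)%N.
  by exists (n - k)%N; rewrite subnKC // -ltnS.
rewrite addKn.
have := q_saalschutz (s * q ^+ k) (m * q ^+ k.*2) t q d hq.
have -> : t * (s * q ^+ k) = t * s * q ^+ k by ring.
have -> : t ^+ 2 * (m * q ^+ k.*2) = t ^+ 2 * m * q ^+ k.*2 by ring.
move=> saal.
transitivity ((qpoch2 s m q k * t ^+ k * alpha k / qpoch (a * q) q (k + d + k))
  * (qpoch2 (t * s * q ^+ k) (t ^+ 2 * m * q ^+ k.*2) q d / qpoch q q d)
  / qpoch2 (t * s) (t ^+ 2 * m) q (k + d)).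
  congr (_ / _); rewrite -saal mulr_sumr; apply: eq_bigr => -[i /= ltid] _.
  have {ltid} [e ->] : exists e, d = (i + e)%N.
    by exists (d - i)%N; rewrite subnKC // -ltnS.
  have -> : (k + (i + e) - (k + i))%N = e by lia.
  have -> : (k + i - k)%N = i by lia.
  have -> : (k + (i + e) + k = (k + i + k) + e)%N by lia.
  (* The relation t m = a q makes this Saalschutz factor a tail of (a q; q)_(n+k). *)
  have -> : t * (m * q ^+ k.*2) * q ^+ i = a * q * q ^+ (k + i + k).
    by rewrite !mulrA tm -addnn !exprD; ring.
  have := haq (k + i + k + e)%N; rewrite addKn qpoch2D qpochD !exprD.
  rewrite mulf_eq0 negb_or => /andP[h1 h2]; field.
  by rewrite h1 h2 !hq.
have := hP (k + d)%N; rewrite qpoch2D mulf_eq0 negb_or => /andP[h1 h2]; field.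
by rewrite h1 h2 haq hq.
Qed.

(** Bailey's lemma is applied to the unit pair first with b and c, where u b = a q/c and u c = a
    q/b, then with the pair given by [s] and [m]. Both sides keep symbols of index n - k in place of
    the parameter q^-n. *)
Lemma watson {a q s t m u b c} n :
    t * m = a * q -> u * (b * c) = a * q ->
    (forall k, qpoch q q k != 0) -> (forall k, qpoch a q k != 0) ->
    (forall k, qpoch2 (t * s) (t ^+ 2 * m) q k != 0) ->
    (forall k, qpoch (u * b) q k != 0) -> (forall k, qpoch (u * c) q k != 0) ->
  \sum_(k < n.+1) qpoch2 s m q k * t ^+ k / qpoch2 (t * s) (t ^+ 2 * m) q k
    * (qpoch b q k * qpoch c q k * u ^+ k
       / (qpoch (u * b) q k * qpoch (u * c) q k) * unit_alpha a q k)
    / (qpoch q q (n - k) * qpoch (a * q) q (n + k))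
  = (\sum_(k < n.+1) qpoch2 s m q k * t ^+ k * qpoch t q (n - k)
       / qpoch q q (n - k)
       * (qpoch u q k
          / (qpoch q q k * (qpoch (u * b) q k * qpoch (u * c) q k))))
    / qpoch2 (t * s) (t ^+ 2 * m) q n.
Proof.
move=> tm ubc hq ha hP hub huc.
have haq k : qpoch (a * q) q k != 0.
  by have := ha k.+1; rewrite qpochSl mulf_eq0 negb_or => /andP[].
have E k : qpoch2 (u * (b + c)) (u ^+ 2 * (b * c)) q k
         = qpoch (u * b) q k * qpoch (u * c) q k.
  by rewrite -qpoch2_mul; congr (qpoch2 _ _ _ _); ring.
have hubc k : qpoch2 (u * (b + c)) (u ^+ 2 * (b * c)) q k != 0.
  by rewrite E mulf_neq0.
have step1 := bailey_lemma ubc hq haq hubc (unit_bailey_pair hq ha).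
have := bailey_lemma tm hq haq hP step1 n.
under [in RHS]eq_bigr do rewrite E qpoch2_mul.
move=> <-; congr (_ / _); apply: eq_bigr => k _; congr (_ * _).
(* The unit sequence leaves only the term j = 0 of the inner sum. *)
rewrite E big_ord_recl /= big1 => [|j _]; last by rewrite mulr0.
by rewrite subn0 qpoch2_0 expr0 !mul1r mulr1 addr0 !invfM !mulrA.
Qed.

End Bailey.

(** * Sears' transformation and the rewriting of terminating series *)

Section Terminating.
Context {K : fieldType}.
Implicit Types (s m t q y T A : K) (j k n : nat).

(* Sears' 4phi3 transformation: the first Saalschutz sum expands the pair
   qpoch2 on the left, the second one evaluates the inner sum. *)
Lemma sears {q} s m t T A n :
    (forall k, qpoch q q k != 0) -> (forall k, qpoch (t * m) q k != 0) ->
    (forall k, qpoch (T * A * t) q k != 0) ->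
  \sum_(k < n.+1) qpoch2 (t * s) (t ^+ 2 * m) q k * T ^+ k * qpoch T q (n - k)
      * qpoch A q k
    / (qpoch q q (n - k) * qpoch q q k * qpoch (t * m) q k
       * qpoch (T * A * t) q k)
  = \sum_(j < n.+1) qpoch2 s m q j * (T * t) ^+ j * qpoch A q j
      * qpoch (T * A * q ^+ j) q (n - j) * qpoch (T * t) q (n - j)
    / (qpoch q q (n - j) * qpoch q q j * qpoch (t * m) q j
       * qpoch (T * A * t) q n).
Proof.
move=> hq htm hv.
pose f k j := t ^+ j * qpoch t q (k - j) * qpoch (t * m * q ^+ j) q (k - j)
  * qpoch2 s m q j / (qpoch q q j * qpoch q q (k - j))
  * (T ^+ k * qpoch T q (n - k) * qpoch A q k
     / (qpoch q q (n - k) * qpoch (t * m) q k * qpoch (T * A * t) q k)).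
transitivity (\sum_(k < n.+1) \sum_(j < k.+1) f k j).
  apply: eq_bigr => k _; rewrite /f -mulr_suml q_saalschutz //.
  by rewrite !invfM; ring.
rewrite exchange_triangle; apply: eq_bigr => -[j /= ltjn] _.
have {ltjn} [d nE] : exists d, n = (j + d)%N.
  by exists (n - j)%N; rewrite subnKC // -ltnS.
have -> : (n - j)%N = d by rewrite nE addKn.
have -> : qpoch (T * A * t) q n = qpoch (T * A * t) q (j + d) by rewrite nE.
(* The inner sum is a q-Saalschutz sum in the pair A q^j, t, with [T] in the role of the
   multiplier. *)
have := q_saalschutz (A * q ^+ j + t) (A * q ^+ j * t) T q d hq.
have -> : T * (A * q ^+ j + t) = T * A * q ^+ j + T * t by ring.
have -> : T ^+ 2 * (A * q ^+ j * t) = (T * A * q ^+ j) * (T * t) by ring.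
rewrite qpoch2_mul => saal.
transitivity (qpoch2 s m q j * (T * t) ^+ j * qpoch A q j
  / (qpoch q q j * qpoch (t * m) q j * qpoch (T * A * t) q (j + d))
  * (qpoch (T * A * q ^+ j) q d * qpoch (T * t) q d / qpoch q q d)); last first.
  by rewrite !invfM; ring.
rewrite -saal mulr_sumr; apply: eq_bigr => -[i /= ltid] _.
have {ltid} [e dE] : exists e, d = (i + e)%N.
  by exists (d - i)%N; rewrite subnKC // -ltnS.
rewrite /f qpoch2_mul dE.
have -> : (n - (j + i))%N = e by lia.
have -> : (j + i - j)%N = i by lia.
rewrite addKn.
have -> : T * (A * q ^+ j * t) * q ^+ i = T * A * t * q ^+ (j + i).
  by rewrite exprD; ring.
rewrite addnA [qpoch (T * A * t) q (j + i + e)]qpochD [qpoch A q _]qpochD.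
have := hv (j + i + e)%N; rewrite qpochD.
have := htm (j + i)%N; rewrite qpochD !exprD.
rewrite !mulf_eq0 !negb_or => /andP[h1 h2] /andP[h3 h4].
by rewrite exprMn; field; rewrite h1 h2 h3 h4 !hq.
Qed.

(** This turns the 1/(q; q)_(n-k) of a Bailey pair into the numerator parameter q^-n. *)
Lemma qpochVn {q} n k : q != 0 -> (forall k, qpoch q q k != 0) -> (k <= n)%N ->
  qpoch (q ^- n) q k
  = (-1) ^+ k * q ^+ 'C(k, 2) * q ^- (n * k) * qpoch q q n / qpoch q q (n - k).
Proof.
move=> q0 hq; elim: k => [|k IHk] lekn.
  by rewrite qpoch0 subn0 bin0n muln0 !expr0 invr1 !mul1r divff.
rewrite qpochS IHk 1?ltnW // binS bin1.
have {IHk lekn} [d ->] : exists d, n = (k + d).+1.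
  by exists (n - k.+1)%N; rewrite -addSn subnKC.
have -> : ((k + d).+1 - k)%N = d.+1 by lia.
rewrite subSS addKn !qpochS mulnS.
have := hq d.+1; have := hq (k + d).+1; rewrite !qpochS !mulf_eq0 !negb_or.
move=> /andP[h1 h2] /andP[h3 h4].
move: h2 h4; rewrite !exprD !exprS !exprD => h2 h4; field.
by rewrite h3 h4 q0 !expf_neq0.
Qed.

Lemma qpochVn_eq0 {q} n k : q != 0 -> (n < k)%N -> qpoch (q ^- n) q k = 0.
Proof.
move=> q0 ltnk; rewrite -(subnKC ltnk) qpochD qpochS mulVf ?expf_neq0 //.
by rewrite subrr mulr0 mul0r.
Qed.

(** Each factor is turned round by 1 - x = -x (1 - 1/x), and the product is read backwards. *)
Lemma qpoch_reflect {q} y j : q != 0 -> y != 0 ->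
  qpoch y q j = (- y) ^+ j * q ^+ 'C(j, 2) * qpoch (q ^ (1 - j%:Z) / y) q j.
Proof.
move=> q0 y0; elim: j => [|j IHj]; first by rewrite !qpoch0 bin0n !expr0 !mulr1.
rewrite qpochS qpochSl IHj binS bin1.
have -> : q ^ (1 - j.+1%:Z) / y * q = q ^ (1 - j%:Z) / y.
  by rewrite mulrAC -[X in _ * X / _]expr1z -expfzDr //; congr (q ^ _ / y); lia.
have -> : q ^ (1 - j.+1%:Z) = q ^- j.
  by rewrite exprnN; congr (q ^ _); lia.
rewrite exprS exprD; field.
by rewrite y0 expf_neq0.
Qed.

(** One recurrence for indices of both signs: at a negative index the new factor cancels an inverse,
    which is legitimate because q^k is never -1. *)
Lemma qpochNS q (d : int) : q != 0 -> (forall k, q ^+ k != -1) ->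
  qpochN q (d + 1) = qpochN q d * (1 + q ^ (d + 1)).
Proof.
move=> q0 hq; case: d => [k|k].
  have -> : k%:Z + 1 = k.+1 by lia.
  by rewrite /= big_nat_recr //= addrC.
have h : q ^- k + 1 != 0.
  apply: contra (hq k) => /eqP e; apply/eqP; rewrite -[LHS]invrK.
  by rewrite -[q ^- k](addrK 1) e sub0r invrN invr1.
have -> : Negz k + 1 = - k%:Z by lia.
rewrite -exprnN.
(* At k = 0 the index passes from -1 to 0 and the factor is 1 + q^0 = 2, nonzero by the hypothesis
   at exponent 0. *)
case: k h => [|k] h.
  rewrite oppr0 /= big_nat1 big_geq // expr0 invr1 mulVf //.
  by rewrite expr0 invr1 in h.
rewrite -NegzE /= [X in _ = X * _]big_nat_recr //= -mulrA [1 + _]addrC mulVf //.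
by rewrite mulr1.
Qed.

(** By [qpochNS], the product of 1 + q^i over 1 - k <= i <= n - k is a ratio of two values of
    [qpochN]. The case n = 0 rests on 1 + q^j = q^j (q^-j + 1), whose powers q^j multiply to
    q^C(k,2). *)
Lemma qpochN_shift {q} k n : q != 0 -> (forall j, q ^+ j != -1) ->
  q ^+ 'C(k, 2) * qpoch (- q ^ (1 - k%:Z)) q n
  = qpochN q (n%:Z - k%:Z) * qpoch (-1) q k.
Proof.
move=> q0 hq; elim: n => [|n IHn].
  rewrite qpoch0 mulr1 sub0r; elim: k => [|k IHk].
    by rewrite oppr0 bin0n qpoch0 /= big_geq // !mulr1.
  rewrite binS bin1 exprD IHk qpochS.
  have -> : - k%:Z = - k.+1%:Z + 1 by lia.
  rewrite qpochNS //.
  have -> : - k.+1%:Z + 1 = - k%:Z by lia.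
  rewrite -exprnN -!mulrA; congr (_ * _).
  rewrite mulrCA; congr (_ * _).
  by field; rewrite expf_neq0.
rewrite qpochS mulrA IHn.
have -> : n.+1%:Z - k%:Z = n%:Z - k%:Z + 1 by lia.
rewrite qpochNS // -!mulrA; congr (_ * _); rewrite mulrC; congr (_ * _).
rewrite mulNr opprK [q ^+ n]exprnP -expfzDr //; congr (1 + q ^ _); lia.
Qed.

End Terminating.

(** The factor (q^-n; q)_i kills every term with i > n. *)
Lemma qhyp_terminating (K : fieldType) s (a : s.+1.-tuple K) (b : s.-tuple K)
    (q y : K) n : q != 0 -> q ^- n \in tval a ->
  qhyp a b q y = \sum_(i < n.+1) qhyp_term a b q y i.
Proof.
move=> q0 an; rewrite /qhyp (fsbig_ord _ _ (qhyp_term a b q y)).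
apply/esym/fsbig_widen => // i [_ /= /negP]; rewrite -leqNgt => ltni.
rewrite /qhyp_term (big_rem _ an) /=.
by rewrite qpochVn_eq0 // !mul0r.
Qed.

(** * Watson's transformation of the two well-poised series *)

Section WellPoised.
Context {K : fieldType}.
Implicit Types (a b c q u z : K) (k n : nat).

Lemma qpoch_sqrS a q k :
  qpoch a (q ^+ 2) k * (1 - a * q ^+ k.*2)
  = (1 - a) * qpoch (a * q ^+ 2) (q ^+ 2) k.
Proof. by rewrite -qpochSl qpochS -exprM mul2n. Qed.

(* Watson's transformation with d, e = +-sqrt a, for which
   (d, e; q)_k / (q d, q e; q)_k = (1 - a) / (1 - a q^(2k)) removes the
   very-well-poised factor. *)
Lemma qhyp_4phi3 {q a b c u} n :
    u * (b * c) = a * q -> q != 0 -> (forall k, qpoch q q k != 0) ->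
    (forall k, qpoch a q k != 0) ->
    (forall k, qpoch (a * q ^+ 2) (q ^+ 2) k != 0) ->
    (forall k, qpoch (u * b) q k != 0) -> (forall k, qpoch (u * c) q k != 0) ->
  qpoch (a * q ^+ 2) (q ^+ 2) n / qpoch (a * q) q n
  * qhyp [tuple b; c; a; q ^- n] [tuple u * c; u * b; q ^+ n * (a * q)]
         q (- (q * q ^+ n * u))
  = qpoch q q n * (\sum_(k < n.+1) qpoch2 0 (- a) q k * (- q) ^+ k
       * qpoch (- q) q (n - k) / qpoch q q (n - k)
       * (qpoch u q k
          / (qpoch q q k * (qpoch (u * b) q k * qpoch (u * c) q k)))).
Proof.
move=> ubc q0 hq ha haq2 hub huc.
have haq k : qpoch (a * q) q k != 0.
  by have := ha k.+1; rewrite qpochSl mulf_eq0 negb_or => /andP[].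
have ha1 : 1 - a != 0.
  by have := ha 1%N; rewrite qpochS qpoch0 mul1r mulr1.
(* The pair +-sqrt a has s = 0 and m = -a, hence t = a q/m = -q. *)
have E k : qpoch2 (- q * 0) ((- q) ^+ 2 * - a) q k
         = qpoch (a * q ^+ 2) (q ^+ 2) k.
  by rewrite mulr0 sqrrN mulrN mulrC qpoch2_sqr.
have hE k : qpoch2 (- q * 0) ((- q) ^+ 2 * - a) q k != 0 by rewrite E.
have tm : - q * - a = a * q by rewrite mulrNN mulrC.
have := watson n tm ubc hq ha hE hub huc.
rewrite E => /(canLR (divfK (haq2 n))) <-.
rewrite (@qhyp_terminating _ _ _ _ _ _ n) //; last first.
  by rewrite !inE eqxx !orbT.
rewrite mulr_suml !mulr_sumr; apply: eq_bigr => -[k /= ltkn] _.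
rewrite E qpoch2_sqr /qhyp_term /unit_alpha !big_cons !big_nil !mulr1.
rewrite qpochVn // [q ^+ n * (a * q)]mulrC.
rewrite [qpoch (a * q) q (n + k)]qpochD.
have := haq (n + k)%N; rewrite qpochD mulf_eq0 negb_or => /andP[_ h].
have -> : (- (q * q ^+ n * u)) ^+ k = (- q) ^+ k * q ^+ (n * k) * u ^+ k.
  by rewrite -!mulNr !exprMn exprM.
have /(canLR (mulKf ha1)) e2 := qpoch_sqrS a q k.
have := haq2 k; rewrite -e2 !mulf_eq0 !negb_or => /and3P[_ h3 h4].
by field; rewrite h haq !hq ha1 huc hub h4 h3 expf_neq0.
Qed.

(* Watson's transformation with d, e = +-z sqrt q, for which (d, e; q)_k and
   (a q/d, a q/e; q)_k cancel and (a q/d e)^k = (-1)^k. *)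
Lemma qhyp_6phi5 {q z b c u} n :
    u * (b * c) = z ^+ 2 * q -> q != 0 -> (forall k, qpoch q q k != 0) ->
    (forall k, qpoch (z ^+ 2) q k != 0) ->
    (forall k, qpoch (z ^+ 2) (q ^+ 2) k != 0) ->
    (forall k, qpoch (q * z ^+ 2) (q ^+ 2) k != 0) ->
    (forall k, qpoch (u * b) q k != 0) -> (forall k, qpoch (u * c) q k != 0) ->
  qpoch (q * z ^+ 2) (q ^+ 2) n / qpoch (q * z ^+ 2) q n
  * qhyp [tuple z ^+ 2; q * z; - (q * z); b; c; q ^- n]
         [tuple z; - z; u * b; u * c; q ^+ n.+1 * z ^+ 2] q (- (q ^+ n * u))
  = qpoch q q n * (\sum_(k < n.+1) qpoch2 0 (- (q * z ^+ 2)) q k * (- 1) ^+ k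
       * qpoch (- 1) q (n - k) / qpoch q q (n - k)
       * (qpoch u q k
          / (qpoch q q k * (qpoch (u * b) q k * qpoch (u * c) q k)))).
Proof.
move=> ubc q0 hq ha ha2 haq2 hub huc.
have haq k : qpoch (z ^+ 2 * q) q k != 0.
  by have := ha k.+1; rewrite qpochSl mulf_eq0 negb_or => /andP[].
have ha1 : 1 - z ^+ 2 != 0.
  by have := ha 1%N; rewrite qpochS qpoch0 mul1r mulr1.
(* Here m = -q z^2 and t = -1, which merely swaps the two members of the pair. *)
have E k : qpoch2 (- 1 * 0) ((- 1) ^+ 2 * - (q * z ^+ 2)) q k
         = qpoch (q * z ^+ 2) (q ^+ 2) k.
  by rewrite mulr0 sqrrN expr1n mul1r qpoch2_sqr.
have hE k : qpoch2 (- 1 * 0) ((- 1) ^+ 2 * - (q * z ^+ 2)) q k != 0.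
  by rewrite E.
have tm : - 1 * - (q * z ^+ 2) = z ^+ 2 * q by rewrite mulrNN mul1r mulrC.
have := watson n tm ubc hq ha hE hub huc.
rewrite E => /(canLR (divfK (haq2 n))) <-.
rewrite (@qhyp_terminating _ _ _ _ _ _ n) //; last first.
  by rewrite !inE eqxx !orbT.
rewrite mulr_suml !mulr_sumr; apply: eq_bigr => -[k /= ltkn] _.
rewrite E qpoch2_sqr /qhyp_term /unit_alpha !big_cons !big_nil !mulr1.
rewrite qpochVn //.
have -> : q ^+ n.+1 * z ^+ 2 = z ^+ 2 * q * q ^+ n by rewrite exprS; ring.
rewrite ![q * z ^+ 2]mulrC.
rewrite [qpoch (z ^+ 2 * q) q (n + k)]qpochD.
have := haq (n + k)%N; rewrite qpochD mulf_eq0 negb_or => /andP[_ h].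
have -> : (- (q ^+ n * u)) ^+ k = (- 1) ^+ k * q ^+ (n * k) * u ^+ k.
  by rewrite [LHS]exprNn !exprMn exprM mulrA.
(* The symbols of qz, -qz over those of z, -z amount to the very-well-poised factor. *)
have := qpoch_sqrS (z ^+ 2) q k.
rewrite -exprMn !qpoch_sqr [z * q]mulrC => /(canLR (mulKf ha1)) e2.
rewrite [qpoch (q * z) q k * (_ * _)]mulrA -e2.
have := ha2 k; have := haq2 k; rewrite qpoch_sqr [q * _]mulrC mulf_eq0 negb_or.
move=> h1 /andP[h2 h3].
by field; rewrite h h1 h2 h3 haq !hq ha1 huc hub expf_neq0.
Qed.

End WellPoised.

(** * The identity over a field, for parameters in general position *)

Section FieldIdentity.
Context {K : fieldType}.

Lemma sum_trunc (F : nat -> K) {m n} : (m <= n)%N ->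
    (forall j, (m < j <= n)%N -> F j = 0) ->
  \sum_(j < n.+1) F j = \sum_(j < m.+1) F j.
Proof.
move/subnKC <-; move: (n - m)%N => d F0; rewrite -addSn big_split_ord /=.
rewrite [X in _ + X]big1 ?addr0 // => -[j /= ltj] _.
by rewrite F0 // addSn ltnS leq_addr -addnS leq_add2l.
Qed.

Lemma bin2D j k : 'C(j + k, 2) = ('C(j, 2) + 'C(k, 2) + j * k)%N.
Proof.
elim: j => [|j IHj]; first by rewrite bin0n !add0n mul0n addn0.
by rewrite addSn !binS !bin1 IHj mulSn; lia.
Qed.

Lemma qhyp_transformation (q w z : K) n r :
    q != 0 -> w != 0 -> z != 0 ->
    (forall k, q ^+ k.+1 != 1) -> (forall k, q ^+ k != -1) ->
    (forall k, w * z * q ^+ k != 1) -> (forall k, z ^+ 2 * q ^+ k != 1) ->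
    (forall k l, w * q ^+ k != z * q ^+ l) ->
    (forall k l, w ^+ 2 * q ^+ k != q ^+ l) ->
  qpoch (q * w ^+ 2) (q ^+ 2) n / qpoch (w ^+ 2) q n
  * (qpoch (q ^- r * w / z) q n / qpoch (w / z) q n)
  * qhyp [tuple w / z; q ^+ r * w * z; w ^+ 2 / q; q ^- n]
         [tuple w * z; q ^- r * w / z; q ^+ n * w ^+ 2]
         q (- q ^ (n%:Z - r%:Z + 1))
  = q ^- 'C(r, 2) * qpochN q (n%:Z - r%:Z)
  * (qpoch (q * z ^+ 2) (q ^+ 2) r / qpoch (q * z ^+ 2) q r)
  * qhyp [tuple z ^+ 2; q * z; - (q * z); q ^+ n * w * z; q * z / w; q ^- r]
         [tuple z; - z; w * z; q ^ (1 - n%:Z) * z / w; q ^+ r.+1 * z ^+ 2]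
         q (- q ^ (r%:Z - n%:Z)).
Proof.
move=> q0 w0 z0 q1 qN1 wz1 zz1 wz ww1.
have qn0 k : q ^+ k != 0 by rewrite expf_neq0.
have hq k : qpoch q q k != 0.
  by apply: qpoch_neq0 => l _; rewrite -exprS.
have hwz k : qpoch (w * z) q k != 0 by apply: qpoch_neq0.
have ha k : qpoch (w ^+ 2 / q) q k != 0.
  apply: qpoch_neq0 => l _; rewrite mulrAC; apply: contra (ww1 l 1%N) => /eqP e.
  by rewrite -[_ * _](divfK q0) e mul1r.
have hv j k : qpoch (q ^- j * w / z) q k != 0.
  apply: qpoch_neq0 => l _; apply: contra (wz l j) => /eqP e; apply/eqP.
  by rewrite [RHS]mulrC -[RHS]mul1r -e; field; rewrite z0 qn0.
have hw k : qpoch (w / z) q k != 0.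
  by have := hv 0%N k; rewrite expr0 invr1 mul1r.
have hzw k : qpoch (q ^ (1 - n%:Z) * z / w) q k != 0.
  apply: qpoch_neq0 => l _; apply: contra (wz n l.+1) => /eqP e.
  apply/eqP; rewrite -[LHS]mul1r -e expfzDr // -exprnN expr1z exprS; field.
  by rewrite w0 qn0.
have hww2 k : qpoch (q * w ^+ 2) (q ^+ 2) k != 0.
  apply: qpoch_neq0 => l _; rewrite mulrAC -exprM -exprS mulrC.
  by have := ww1 (2 * l).+1 0%N.
have hz2 k : qpoch (z ^+ 2) q k != 0 by apply: qpoch_neq0.
have hzz2 k : qpoch (z ^+ 2) (q ^+ 2) k != 0.
  by apply: qpoch_neq0 => l _; rewrite -exprM.
have hqzz2 k : qpoch (q * z ^+ 2) (q ^+ 2) k != 0.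
  by apply: qpoch_neq0 => l _; rewrite mulrAC -exprM -exprS mulrC.
(* Sears' parameters: m = -q z^2 comes from Watson on the right-hand side, and t = -w/(q z) is
   chosen so that t^2 m = -w^2/q, the value on the left; T = -q and A = q^-r are also read off the
   left. *)
have f1 : - (w / (q * z)) * 0 = 0 by rewrite mulr0.
have f2 : (- (w / (q * z))) ^+ 2 * - (q * z ^+ 2) = - (w ^+ 2 / q).
  by field; rewrite q0 z0.
have f3 : - (w / (q * z)) * - (q * z ^+ 2) = w * z by field; rewrite q0 z0.
have f4 : - q * q ^- r * - (w / (q * z)) = q ^- r * w / z.
  by field; rewrite q0 z0 qn0.
have f5 : - q * - (w / (q * z)) = w / z by field; rewrite q0 z0.
have := @sears K q 0 (- (q * z ^+ 2)) (- (w / (q * z))) (- q) (q ^- r) n.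
rewrite f1 f2 f3 f4 f5 => /(_ hq hwz (hv r)) S {f1 f2 f3 f4 f5}.
(* Watson with a = w^2/q, b = w/z, c = q^r w z, u = q^-r, followed by Sears. *)
have L : qpoch (q * w ^+ 2) (q ^+ 2) n / qpoch (w ^+ 2) q n
  * qhyp [tuple w / z; q ^+ r * w * z; w ^+ 2 / q; q ^- n]
         [tuple w * z; q ^- r * w / z; q ^+ n * w ^+ 2]
         q (- q ^ (n%:Z - r%:Z + 1)) =
  qpoch q q n * \sum_(j < n.+1) qpoch2 0 (- (q * z ^+ 2)) q j * (w / z) ^+ j
      * qpoch (q ^- r) q j * qpoch (- q * q ^- r * q ^+ j) q (n - j)
      * qpoch (w / z) q (n - j)
    / (qpoch q q (n - j) * qpoch q q j * qpoch (w * z) q j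
       * qpoch (q ^- r * w / z) q n).
  have e1 : w ^+ 2 / q * q ^+ 2 = q * w ^+ 2 by field.
  have e2 : w ^+ 2 / q * q = w ^+ 2 by field.
  have e3 : q ^- r * (q ^+ r * w * z) = w * z by field.
  have e4 : q ^- r * (w / z) = q ^- r * w / z by rewrite mulrA.
  have e5 : q * q ^+ n * q ^- r = q ^ (n%:Z - r%:Z + 1).
    by rewrite !expfzDr // -exprnN expr1z; rewrite -!exprnP; ring.
  have := @qhyp_4phi3 K q (w ^+ 2 / q) (w / z) (q ^+ r * w * z) (q ^- r) n.
  rewrite e1 e2 e3 e4 e5 => -> //; last by rewrite mulrCA e3; field.
  congr (_ * _); rewrite -S; apply: eq_bigr => k _.
  by rewrite !invfM; ring.
(* Watson with a = z^2, b = q^n w z, c = q z/w, u = q^-n. *)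
have R : qpoch (q * z ^+ 2) (q ^+ 2) r / qpoch (q * z ^+ 2) q r
  * qhyp [tuple z ^+ 2; q * z; - (q * z); q ^+ n * w * z; q * z / w; q ^- r]
         [tuple z; - z; w * z; q ^ (1 - n%:Z) * z / w; q ^+ r.+1 * z ^+ 2]
         q (- q ^ (r%:Z - n%:Z)) =
  qpoch q q r * (\sum_(k < r.+1) qpoch2 0 (- (q * z ^+ 2)) q k * (- 1) ^+ k
       * qpoch (- 1) q (r - k) / qpoch q q (r - k)
       * (qpoch (q ^- n) q k / (qpoch q q k
          * (qpoch (w * z) q k * qpoch (q ^ (1 - n%:Z) * z / w) q k)))).
  have e1 : q ^- n * (q ^+ n * w * z) = w * z by field.
  have e2 : q ^- n * (q * z / w) = q ^ (1 - n%:Z) * z / w.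
    by rewrite expfzDr // -exprnN expr1z; ring.
  have e3 : q ^+ r * q ^- n = q ^ (r%:Z - n%:Z).
    by rewrite expfzDr // -exprnN.
  have := @qhyp_6phi5 K q z (q ^+ n * w * z) (q * z / w) (q ^- n) r.
  rewrite e1 e2 e3; apply => //.
  by rewrite mulrA e1; field.
rewrite mulrAC L -[RHS]mulrA R {L R}.
rewrite {S} !mulr_sumr mulr_suml.
pose F j := qpoch q q n * (qpoch2 0 (- (q * z ^+ 2)) q j * (w / z) ^+ j
    * qpoch (q ^- r) q j * qpoch (- q / q ^+ r * q ^+ j) q (n - j)
    * qpoch (w / z) q (n - j)
    / (qpoch q q (n - j) * qpoch q q j * qpoch (w * z) q j
       * qpoch (q ^- r * w / z) q n))
  * (qpoch (q ^- r * w / z) q n / qpoch (w / z) q n).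
pose G j := q ^- 'C(r, 2) * qpochN q (n%:Z - r%:Z)
  * (qpoch q q r * (qpoch2 0 (- (q * z ^+ 2)) q j * (-1) ^+ j
    * qpoch (-1) q (r - j) / qpoch q q (r - j)
    * (qpoch (q ^- n) q j / (qpoch q q j * (qpoch (w * z) q j
       * qpoch (q ^ (1 - n%:Z) * z / w) q j))))).
(* (q^-r; q)_j cuts the left sum at r and (q^-n; q)_j the right one at n, so both run up to min(n,
   r). *)
rewrite (sum_trunc F (geq_minl n r)) => [|j /andP[ltj lejn]]; last first.
  rewrite /F qpochVn_eq0 ?(mulr0, mul0r) //.
  by move: ltj; rewrite gtn_min ltnNge lejn.
rewrite (sum_trunc G (geq_minr n r)) => [|j /andP[ltj lejr]]; last first.
  rewrite /G qpochVn_eq0 ?(mulr0, mul0r) //.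
  by move: ltj; rewrite gtn_min [(r < j)%N]ltnNge lejr orbF.
apply: eq_bigr => -[j /=]; rewrite ltnS leq_min => /andP[lejn lejr] _.
rewrite /F /G !qpochVn //.
(* The last j factors, reversed, yield the denominator (q^(1-n) z/w; q)_j of the right-hand side. *)
have -> : qpoch (w / z) q n
    = qpoch (w / z) q (n - j) * qpoch (w / z * q ^+ (n - j)) q j.
  by rewrite -qpochD subnK.
rewrite [qpoch (w / z * _) q j]qpoch_reflect ?mulf_neq0 ?invr_eq0 //.
have -> : q ^ (1 - j%:Z) / (w / z * q ^+ (n - j)) = q ^ (1 - n%:Z) * z / w.
  rewrite -[n in RHS](subnKC lejn) PoszD opprD addrA [in RHS]expfzDr // -exprnN.
  by field; rewrite w0 z0 qn0.
have -> : - q / q ^+ r * q ^+ j = - q ^ (1 - (r - j)%:Z).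
  rewrite -[r in LHS](subnKC lejr) exprD expfzDr // -exprnN expr1z.
  by field; rewrite !qn0.
(* The index (n - j) - (r - j) = n - r is free of j, so (-q; q)_(n-r) comes out as a constant. *)
have := qpochN_shift (r - j) (n - j) q0 qN1.
have -> : (n - j)%:Z - (r - j)%:Z = n%:Z - r%:Z by lia.
move=> /(canRL (mulKf (qn0 _))) ->.
have [d nE] : exists d, n = (j + d)%N by exists (n - j)%N; rewrite subnKC.
have [e rE] : exists e, r = (j + e)%N by exists (r - j)%N; rewrite subnKC.
have -> : (n - j)%N = d by rewrite nE addKn.
have -> : (r - j)%N = e by rewrite rE addKn.
have -> : q ^+ (n * j) = q ^+ (j * j) * q ^+ (d * j).
  by rewrite nE mulnDl exprD.
have -> : q ^+ (r * j) = q ^+ (j * j) * q ^+ (j * e).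
  by rewrite rE mulnDl exprD [(e * j)%N]mulnC.
have -> : q ^+ 'C(r, 2) = q ^+ 'C(j, 2) * q ^+ 'C(e, 2) * q ^+ (j * e).
  by rewrite rE bin2D !exprD.
have -> : (- (w / z * q ^+ d)) ^+ j = (- 1) ^+ j * (w / z) ^+ j * q ^+ (d * j).
  by rewrite [LHS]exprNn exprMn -exprM mulrA.
(* Only the parity of j matters for the sign; [field] then settles each parity. *)
rewrite -[(-1) ^+ j]signr_odd.
have x0 : (w / z) ^+ j != 0 by rewrite expf_neq0 // mulf_neq0 ?invr_eq0.
by case: (odd j); rewrite ?expr1 ?expr0; field;
  rewrite ?oppr_eq0 ?oner_neq0 x0 hwz hv hw hzw !hq !qn0.
Qed.

End FieldIdentity.

(** * Independence of monomials in the three indeterminates *)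

Section Indeterminates.
Import mpoly.
Context {F : fieldType}.

Let X i := indet F (inord i).

Definition mnm3 a b c : 'X_{1..3} :=
  (U_(inord 0) *+ a + U_(inord 1) *+ b + U_(inord 2) *+ c)%MM.

Lemma mnm3_inj a b c a' b' c' :
  mnm3 a b c = mnm3 a' b' c' -> [/\ a = a', b = b' & c = c'].
Proof.
have E i j : (i < 3)%N -> (j < 3)%N -> (inord i == inord j :> 'I_3) = (i == j).
  by move=> ? ?; rewrite -val_eqE /= !inordK.
move/mnmP => e; move: (e (inord 0)) (e (inord 1)) (e (inord 2)).
rewrite !mnmDE !mulmnE !mnm1E !E //= !mul0n !mul1n !addn0 !add0n.
by split.
Qed.

Lemma indet_monomial a b c :
  X 0 ^+ a * X 1 ^+ b * X 2 ^+ c = tofrac ('X_[mnm3 a b c] : {mpoly F[3]}).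
Proof. by rewrite !mpolyXD -!mpolyXn !rmorphM !rmorphXn. Qed.

(** The embedding of polynomials into fractions is injective, so the coefficient at [mnm3 a b c] can
    be compared. *)
Lemma indet_monomial_inj a b c a' b' c' :
    X 0 ^+ a * X 1 ^+ b * X 2 ^+ c = X 0 ^+ a' * X 1 ^+ b' * X 2 ^+ c' ->
  [/\ a = a', b = b' & c = c'].
Proof.
rewrite !indet_monomial => /eqP; rewrite tofrac_eq => /eqP.
move/(congr1 (mcoeff (mnm3 a b c))) => /eqP; rewrite !mcoeffX eqxx.
case: (mnm3 a' b' c' =P _) => [/esym/mnm3_inj //|_].
by rewrite oner_eq0.
Qed.

(** At the monomial of the power the coefficients are 1 on the left and, on the right, 0 or (when k
    = 0) -1; the latter case would give 2 = 0. *)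
Lemma indet_exp_neqN1 i k : 2%:R != 0 :> F -> indet F i ^+ k != -1.
Proof.
move=> F2; rewrite -tofracXn -[X in _ != - X]tofrac1 -tofracN tofrac_eq mpolyXn.
apply: contraNneq F2 => /(congr1 (mcoeff (U_(i) *+ k))) /eqP.
rewrite mcoeffX eqxx mcoeffN mcoeff1; case: (_ =P 0%MM) => _.
  by rewrite -subr_eq0 opprK.
by rewrite oppr0 oner_eq0.
Qed.

End Indeterminates.

Theorem theorem9 (F : fieldType) (F2 : 2%:R != 0 :> F)
    (n r : nat) (n_gt0 : (1 <= n)%N) :
  let q : ratfun3 F := indet F (inord 0) in
  let w : ratfun3 F := indet F (inord 1) in
  let z : ratfun3 F := indet F (inord 2) in
  qpoch (q * w ^+ 2) (q ^+ 2) n / qpoch (w ^+ 2) q n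
  * (qpoch (q ^- r * w / z) q n / qpoch (w / z) q n)
  * qhyp [tuple w / z; q ^+ r * w * z; w ^+ 2 / q; q ^- n]
         [tuple w * z; q ^- r * w / z; q ^+ n * w ^+ 2]
         q (- q ^ (n%:Z - r%:Z + 1))
  = q ^- 'C(r, 2) * qpochN q (n%:Z - r%:Z)
  * (qpoch (q * z ^+ 2) (q ^+ 2) r / qpoch (q * z ^+ 2) q r)
  * qhyp [tuple z ^+ 2; q * z; - (q * z); q ^+ n * w * z; q * z / w; q ^- r]
         [tuple z; - z; w * z; q ^ (1 - n%:Z) * z / w; q ^+ r.+1 * z ^+ 2]
         q (- q ^ (r%:Z - n%:Z)).
Proof.
move=> q w z.
(* Apart from the nonvanishing of q, w, z and [q ^+ k != -1], each condition of
   [qhyp_transformation] says that two monomials with different exponents differ. *)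
have monomial_neq a b c a' b' c' : (a, b, c) <> (a', b', c') ->
    q ^+ a * w ^+ b * z ^+ c != q ^+ a' * w ^+ b' * z ^+ c'.
  move=> ne; apply/eqP => /indet_monomial_inj [ea eb ec].
  by apply: ne; congr (_, _, _).
have indet_neq0 i : indet F i != 0.
  rewrite tofrac_eq0; apply/eqP.
  move/(congr1 (mpoly.mcoeff (mpoly.mnm1 i))) => /eqP.
  by rewrite mpoly.mcoeffX mpoly.mcoeff0 eqxx oner_eq0.
apply: qhyp_transformation => [|||k|k|k|k|k l|k l]; try exact: indet_neq0.
- by have := monomial_neq k.+1 0 0 0 0 0; rewrite !expr0 !mulr1; apply.
- exact: indet_exp_neqN1.
- have := monomial_neq k 1 1 0 0 0; rewrite !expr0 !mulr1 !expr1 -mulrA mulrC.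
  by apply.
- have := monomial_neq k 0 2 0 0 0; rewrite !expr0 !mulr1 mulrC.
  by apply.
- have := monomial_neq k 1 0 l 0 1; rewrite !expr0 !mulr1 !expr1.
  by rewrite ![_ * q ^+ _]mulrC; apply.
- have := monomial_neq k 2 0 l 0 0; rewrite !expr0 !mulr1 [w ^+ 2 * _]mulrC.
  by apply.
Qed.
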